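(* Consider ParaOpt for a terminal-cost objective applied to a linear diffusive equation, with affine fine and coarse propagators satisfying the standing assumptions (i)-(iii) of the context. Let $\rho$ be the ParaOpt convergence factor, i.e. the spectral radius of $S=I-\tilde A^{-1}A$. Then $$\rho\le\rho^*:=\max_{\sigma\in\mathrm{eig}(K)}\max\left(\frac{|\varphi-\tilde\varphi|}{1-\tilde\varphi},\,|x^*|\right),$$ where, for each $\sigma$, $x^*$ is the (real) root with the largest magnitude of $$f_\infty(x):=\frac{\tilde\psi-\psi}{\tilde\psi+1\big/\sum_{l=0}^{\infty}\left(\tilde\varphi+\frac{\varphi-\tilde\varphi}{x}\right)^{2l}}-x .$$
   Context: Let $M\ge1$ and $\widehat L\ge1$ be integers ($M$ is the state dimension; for terminal cost with $L$ time sub-intervals, $\widehat L=L$). ''Linear diffusive'' means the state equation is $\mathbf y'(t)=-K\mathbf y(t)+\mathbf u(t)$ with $K=K^\top\in\mathbb R^{M\times M}$ having only positive eigenvalues $\sigma$. Standing assumptions. (i) On each sub-interval $l$ the fine propagators are affine, $\mathcal P(\mathbf y,\boldsymbol\lambda)=\Phi_{\mathcal P}\mathbf y-\Psi_{\mathcal P}\boldsymbol\lambda+\mathbf b_{\mathcal P,l}$ and $\mathcal Q(\mathbf y,\boldsymbol\lambda)=\Psi_{\mathcal Q}\mathbf y+\Phi_{\mathcal Q}\boldsymbol\lambda+\mathbf b_{\mathcal Q,l}$, with matrices in $\mathbb R^{M\times M}$ independent of $l$; the coarse propagators $\tilde{\mathcal P},\tilde{\mathcal Q}$ have the same form with matrices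 $\tilde\Phi_{\mathcal P},\tilde\Psi_{\mathcal P},\tilde\Psi_{\mathcal Q},\tilde\Phi_{\mathcal Q}$. (ii) $\Phi_{\mathcal P}=\Phi_{\mathcal Q}=:\Phi$, $\Psi_{\mathcal Q}=0$, $\Psi_{\mathcal P}=:\Psi$, likewise $\tilde\Phi_{\mathcal P}=\tilde\Phi_{\mathcal Q}=:\tilde\Phi$, $\tilde\Psi_{\mathcal Q}=0$, $\tilde\Psi_{\mathcal P}=:\tilde\Psi$, and $K,\Phi,\Psi,\tilde\Phi,\tilde\Psi$ are simultaneously diagonalizable; their corresponding eigenvalues (for a common eigenvector) are denoted $\sigma,\varphi,\psi,\tilde\varphi,\tilde\psi$. (iii) All these eigenvalues satisfy $0<\varphi<1$, $0<\tilde\varphi<1$, $\psi>0$, $\tilde\psi>0$. The notation $\max_{\sigma\in\mathrm{eig}(K)}$ means the maximum over the eigenvalues of $K$ counted with multiplicity, i.e. over the common eigenvectors, each with its tuple $(\sigma,\varphi,\psi,\tilde\varphi,\tilde\psi)$. Let $N\in\mathbb R^{\widehat L\times\widehat L}$ have ones on its first sub-diagonal and zeros elsewhere, and let $E\in\mathbb R^{\widehat L\times\widehat L}$ be zero except for a one in the bottom-right corner. With $\otimes$ the Kronecker product, $$A=\begin{bmatrix} I\otimes I-N\otimes\Phi & I\otimes\Psi\\ -E\otimes I & I\otimes I-N^\top\otimes\Phi\end{bmatrix},\qquad \tilde A=\begin{bmatrix} I\otimes I-N\otimes\tilde\Phi & I\otimes\tilde\Psi\\ -E\otimes I & I\otimes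 I-N^\top\otimes\tilde\Phi\end{bmatrix}$$ (matrices of size $2M\widehat L$). In this setting the ParaOpt iteration is $\mathbf x^{k}=(I-\tilde A^{-1}A)\mathbf x^{k-1}+\tilde A^{-1}\mathbf b$, $S=I-\tilde A^{-1}A$ is the ParaOpt iteration matrix, and the convergence factor is $\rho=$ spectral radius of $S$. Convention in $f_\infty$: when the infinite sum diverges it equals $+\infty$ and its reciprocal is $0$; for $x=0$, $f_\infty(0)$ is understood as the limit of $f_\infty(x)$ as $x\to0$ (so the reciprocal of the sum is $0$ at $x=0$ if $\varphi\ne\tilde\varphi$, and is $1-\tilde\varphi^2$ if $\varphi=\tilde\varphi$). *)

(* Defs.v *)
From HB Require Import structures.
From mathcomp Require Import all_boot all_order all_algebra.
From mathcomp Require Import complex mxtens.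
From mathcomp Require Import all_classical all_reals all_analysis.
Set Implicit Arguments.
Unset Strict Implicit.
Unset Printing Implicit Defensive.
Import Order.TTheory GRing.Theory Num.Theory.
Import numFieldNormedType.Exports.
Local Open Scope classical_set_scope.
Local Open Scope ring_scope.

(* P l and Q l are the state and adjoint propagators on the l-th sub-interval;
   the matrices do not depend on l, the constant terms may. *)
Definition affine_propagators (R : realType) (M L : nat)
    (PhiP PsiP PsiQ PhiQ : 'M[R]_M)
    (P Q : 'I_L -> 'cV[R]_M -> 'cV[R]_M -> 'cV[R]_M) : Prop :=
  exists bP bQ : 'I_L -> 'cV[R]_M, forall l y lam,
    P l y lam = PhiP *m y - PsiP *m lam + bP l /\
    Q l y lam = PsiQ *m y + PhiQ *m lam + bQ l.

Definition subdiag_mx (R : realType) (L : nat) : 'M[R]_L :=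
  \matrix_(i, j) (i == j.+1 :> nat)%:R.

Definition corner_mx (R : realType) (L : nat) : 'M[R]_L :=
  \matrix_(i, j) ((i.+1 == L) && (j.+1 == L))%:R.

Definition paraopt_mx (R : realType) (M L : nat) (Phi Psi : 'M[R]_M) :
    'M[R]_(L * M + L * M) :=
  let I_L : 'M[R]_L := 1%:M in
  let I_M : 'M[R]_M := 1%:M in
  let N := subdiag_mx R L in
  block_mx (tensmx I_L I_M - tensmx N Phi) (tensmx I_L Psi)
           (- tensmx (corner_mx R L) I_M) (tensmx I_L I_M - tensmx N^T Phi).

Definition paraopt_iter_mx (R : realType) (M L : nat)
    (Phi Psi Phit Psit : 'M[R]_M) : 'M[R]_(L * M + L * M) :=
  1%:M - invmx (paraopt_mx L Phit Psit) *m paraopt_mx L Phi Psi.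

(* The supremum of a nonempty finite set when n > 0, hence a maximum; the
   eigenvalues of a real matrix are taken in R[i]. *)
Definition spectral_radius (R : realType) (n : nat) (S : 'M[R]_n) : R :=
  sup [set Normc.normc z |
        z in [set z : R[i] | eigenvalue (map_mx (real_complex R) S) z]].

(* X is diagonalized by the columns of V, with eigenvalues d. *)
Definition diagonalized_by (R : realType) (M : nat) (V : 'M[R]_M)
    (X : 'M[R]_M) (d : 'I_M -> R) : Prop :=
  forall i, X *m col i V = d i *: col i V.

(* The series is computed in \bar R, where +oo^-1 = 0. *)
Definition f_infty_expr (R : realType) (phi psi phit psit x : R) : R :=
  (psit - psi) /
    (psit +
       fine (\sum_(0 <= l <oo) ((phit + (phi - phit) / x) ^+ (2 * l))%:E)^-1%E)
  - x.

Definition f_infty (R : realType) (phi psi phit psit x : R) : R :=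
  if x == 0 then lim (f_infty_expr phi psi phit psit y @[y --> 0^'])
  else f_infty_expr phi psi phit psit x.

Definition largest_root (R : realType) (f : R -> R) (x : R) : Prop :=
  f x = 0 /\ forall y, f y = 0 -> `|y| <= `|x|.

Definition rho_star (R : realType) (M : nat) (phi phit xs : 'I_M -> R) : R :=
  \big[Num.max/0]_(i < M)
    Num.max (`|phi i - phit i| / (1 - phit i)) `|xs i|.

(* Main.v *)
Require Import Defs.
From HB Require Import structures.
From mathcomp Require Import all_boot all_order all_algebra.
From mathcomp Require Import ring lra.
From mathcomp Require Import complex mxtens.
From mathcomp Require Import all_classical all_reals all_analysis.
Import Order.TTheory GRing.Theory Num.Theory.
Import numFieldNormedType.Exports.
Local Open Scope classical_set_scope.
Local Open Scope ring_scope.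

(* For z <> 0, z is an eigenvalue of S iff A - (1 - z) At is singular, and this
   pencil is z times a matrix of the same shape as A, with Phi and Psi replaced
   by Phit + (Phi - Phit)/z and Psit + (Psi - Psit)/z. Diagonalizing and
   eliminating, z is a root of z + (psit z - (psit - psi)) s = 0 for some common
   eigenvector, where s is the sum of a^(2l) over l < L and
   a = phit + (phi - phit)/z. If |z| > |phi - phit|/(1 - phit), then a lies in
   the disc |a - phit| < 1 - phit, where Im ((a - phit) s) has the sign of Im a;
   this forces z to be real. For real z one has 1/s >= 1 - a^2, and the
   intermediate value theorem gives a root of f_infty at least as large as z in
   magnitude. *)

(** * Imaginary parts of complex geometric sums *)

Section ComplexGeometric.
Context {R : rcfType}.
Local Notation normc := (@Normc.normc R).
Local Notation Re := (@complex.Re R).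
Local Notation Im := (@complex.Im R).
Local Open Scope complex_scope.
Implicit Types (a z w : R[i]) (p t : R) (n l : nat).

Lemma complex_ImM z w : Im (z * w) = Re z * Im w + Im z * Re w.
Proof. by case: z => ? ?; case: w. Qed.

Lemma normc_sqrE z : normc z ^+ 2 = Re z ^+ 2 + Im z ^+ 2.
Proof. by case: z => x y; rewrite sqr_sqrtr ?addr_ge0 ?sqr_ge0. Qed.

(** Recovers the sign of [Im w] when only [z * w] is known in closed form, so that quotients by [z]
    need not be expanded. *)
Lemma sqr_normcM_Im z w : normc z ^+ 2 * Im w = Im (z^* * (z * w)).
Proof. by rewrite normc_sqrE; case: z w => x y [u v] /=; ring. Qed.

Lemma normc_ge0 z : 0 <= normc z.
Proof. by case: z => x y; exact: sqrtr_ge0. Qed.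

Lemma normc_real t : normc t%:C = `|t|.
Proof. by rewrite /= expr0n /= addr0 sqrtr_sqr. Qed.

Lemma normcX z n : normc (z ^+ n) = normc z ^+ n.
Proof.
elim: n => [|n IH]; first by rewrite !expr0 Normc.normc1.
by rewrite !exprS Normc.normcM IH.
Qed.

Lemma normRe_le_normc z : `|Re z| <= normc z.
Proof.
rewrite -(@ler_pXn2r _ 2) ?nnegrE ?normc_ge0 //.
by rewrite real_normK ?num_real // normc_sqrE lerDl sqr_ge0.
Qed.

Lemma normIm_expr a n : `|Im (a ^+ n.+1)| <= n.+1%:R * normc a ^+ n * `|Im a|.
Proof.
elim: n => [|n IH]; first by rewrite expr1 expr0 !mul1r.
rewrite [a ^+ _]exprS complex_ImM (le_trans (ler_normD _ _)) // !normrM.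
have h1 : `|Re a| * `|Im (a ^+ n.+1)| <=
    normc a * (n.+1%:R * normc a ^+ n * `|Im a|).
  by rewrite ler_pM ?normRe_le_normc.
have h2 : `|Im a| * `|Re (a ^+ n.+1)| <= `|Im a| * normc a ^+ n.+1.
  by rewrite ler_wpM2l // -normcX normRe_le_normc.
rewrite (le_trans (lerD h1 h2)) // exprS -[n.+2%:R]natr1 le_eqVlt.
by apply/orP; left; apply/eqP; ring.
Qed.

(** Every exponent in the sum is below [(2 * L).+1]. The power on the left is the one that
    [normIm_expr] produces for [a ^+ (2 * L.+1)]. *)
Lemma sum_expr_ge (r : R) L : 0 <= r <= 1 ->
  L.+1%:R * r ^+ (2 * L).+1 <= \sum_(l < L.+1) r ^+ (2 * l).
Proof.
case/andP=> r0 r1; rewrite mulr_natl -[X in _ *+ X]card_ord -sumr_const ler_sum // => l _.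
by rewrite ler_wiXn2l // (leq_trans _ (leqnSn _)) // leq_mul2l /= -ltnS.
Qed.

Lemma geometric_sqrE (F : comNzRingType) (a : F) L :
  (1 - a ^+ 2) * (\sum_(l < L) a ^+ (2 * l)) = 1 - a ^+ (2 * L).
Proof.
rewrite exprM -[RHS]opprB subrX1 -(mulNr (a ^+ 2 - 1)) opprB; congr (_ * _).
by apply: eq_bigr => l _; rewrite exprM.
Qed.

(* Clearing the denominator [|1 - a^2|^2] of the geometric sum reduces the
   claim to [2 |X| <= (1 + r^2 - 2 p x) (1 - r^2)], where
   [X = Re ((a - p) (1 - conj a ^ 2))] and [r = |a|]. The hypothesis says
   [2 p (1 - x) <= 1 - r^2]. *)
Lemma Im_geometric_sum a p L : 0 <= p -> normc (a - p%:C) <= 1 - p ->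
  0 <= Im a * Im ((a - p%:C) * \sum_(l < L.+1) a ^+ (2 * l)).
Proof.
move=> p0 hap.
have [->|y_neq0] := eqVneq (Im a) 0; first by rewrite mul0r.
set s := \sum_(l < L.+1) _.
set r := normc a; have r0 : 0 <= r by exact: normc_ge0.
have r2E : r ^+ 2 = Re a ^+ 2 + Im a ^+ 2 by exact: normc_sqrE.
have p1 : 0 <= 1 - p by apply: le_trans hap; exact: normc_ge0.
have hdisc : 2 * p * (1 - Re a) <= 1 - r ^+ 2.
  move: hap; rewrite -(@ler_pXn2r _ 2) ?nnegrE ?normc_ge0 //.
  by rewrite normc_sqrE r2E; case: (a) => x y /=; rewrite oppr0 addr0; lra.
have x1 : Re a <= 1.
  have := le_trans (ler_norm _) (le_trans (normRe_le_normc (a - p%:C)) hap).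
  by case: (a) => x y /=; lra.
have q0 : 0 <= 1 - r ^+ 2.
  by apply: le_trans hdisc; rewrite !mulr_ge0 // subr_ge0.
have r1 : r <= 1 by nra.
have := geometric_sqrE _ a L.+1; rewrite -/s => sE.
set A := a ^+ (2 * _) in sE.
have AR : Re A <= r ^+ (2 * L.+1).
  rewrite /r -normcX; exact: le_trans (ler_norm _) (normRe_le_normc _).
(* The same [g] bounds [Im A] from above and, multiplied by [1 - r ^+ 2], bounds [1 - Re A] from
   below; this makes the two terms of the final identity comparable. *)
set g := L.+1%:R * r ^+ (2 * L).+1.
have AI : `|Im A| <= 2 * g * `|Im a|.
  have := normIm_expr a (2 * L).+1.
  have -> : (2 * L).+2 = (2 * L.+1)%N by rewrite mulnS.
  rewrite natrM -/r -/A.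
  by rewrite /g mulrA.
have g0 : 0 <= g by rewrite mulr_ge0 ?exprn_ge0 ?ler0n.
have hg : (1 - r ^+ 2) * g <= 1 - Re A.
  have h1 : (1 - r ^+ 2) * g <= 1 - r ^+ (2 * L.+1).
    by rewrite -geometric_sqrE ler_wpM2l // sum_expr_ge ?r0.
  by apply: (le_trans h1); rewrite lerB.
(* [D] is positive because [Im a] is nonzero, which excludes [a = 1] and [a = -1]. *)
set D := normc (1 - a ^+ 2) ^+ 2.
have D0 : 0 < D.
  rewrite exprn_gt0 // lt_def normc_ge0 andbT.
  apply: contra y_neq0 => /eqP /Normc.eq0_normc /eqP.
  rewrite subr_eq0 eq_sym sqrf_eq1 => /orP[] /eqP ->; rewrite /= ?oppr0 //.
rewrite -(pmulr_rge0 _ D0).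
set X := Re a * (1 - r ^+ 2) - p * (1 - Re a ^+ 2 + Im a ^+ 2).
have -> : D * (Im a * Im ((a - p%:C) * s)) =
    Im a ^+ 2 * (1 + r ^+ 2 - 2 * p * Re a) * (1 - Re A) - X * (Im a * Im A).
  rewrite mulrCA sqr_normcM_Im [(1 - a ^+ 2) * (_ * s)]mulrCA sE /X r2E.
  by case: (A) => u v; case: (a) => x y; rewrite expr2 /=; ring.
have hY : 0 <= 1 + r ^+ 2 - 2 * p * Re a.
  have -> : 1 + r ^+ 2 - 2 * p * Re a =
      (Re a - p) ^+ 2 + Im a ^+ 2 + (1 - p) * (1 + p) by rewrite r2E; ring.
  by rewrite !addr_ge0 ?sqr_ge0 // mulr_ge0 // addr_ge0.
have h2X : `|2 * X| <= (1 + r ^+ 2 - 2 * p * Re a) * (1 - r ^+ 2).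
  (* Each of the two bounds on [2 * X] follows from an explicit decomposition into nonnegative
     terms; the lower one uses [hdisc], the upper one [Re a <= 1]. *)
  rewrite ler_norml -subr_ge0 -[X in _ && X]subr_ge0; apply/andP; split.
    have -> : 2 * X - - ((1 + r ^+ 2 - 2 * p * Re a) * (1 - r ^+ 2)) =
       ((1 + Re a) ^+ 2 + Im a ^+ 2) * (1 - r ^+ 2 - 2 * p * (1 - Re a)).
      by rewrite /X r2E; ring.
    by rewrite mulr_ge0 ?subr_ge0 // addr_ge0 ?sqr_ge0.
  have -> : (1 + r ^+ 2 - 2 * p * Re a) * (1 - r ^+ 2) - 2 * X =
      ((1 - Re a) ^+ 2 + Im a ^+ 2) * (1 - r ^+ 2)
      + 2 * p * ((1 - Re a) * (1 - r ^+ 2) + 2 * Im a ^+ 2).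
    by rewrite /X r2E; ring.
  have x1' : 0 <= 1 - Re a by rewrite subr_ge0.
  apply: addr_ge0; first by rewrite mulr_ge0 // addr_ge0 ?sqr_ge0.
  by rewrite mulr_ge0 ?mulr_ge0 // addr_ge0 // mulr_ge0 // sqr_ge0.
rewrite subr_ge0; apply: (le_trans (ler_norm _)); rewrite !normrM.
(* The chain applies [AI], then [h2X], then [hg]. *)
apply: (@le_trans _ _ (`|2 * X| * Im a ^+ 2 * g)).
  rewrite normrM normr_nat -(real_normK (num_real (Im a))).
  have := ler_wpM2l (mulr_ge0 (normr_ge0 X) (normr_ge0 (Im a))) AI; lra.
apply: (@le_trans _ _ ((1 + r ^+ 2 - 2 * p * Re a) * (1 - r ^+ 2) * Im a ^+ 2 * g)).
  by rewrite ler_wpM2r // ler_wpM2r ?sqr_ge0.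
have := ler_wpM2l (mulr_ge0 (sqr_ge0 (Im a)) hY) hg; lra.
Qed.

End ComplexGeometric.

(** * The reciprocal of the infinite geometric series *)

Section GeometricSeries.
Context {R : realType}.
Implicit Types (a b p d t x : R).

(** For [a ^+ 2 < 1] the series converges to the inverse of [1 - a ^+ 2]. Otherwise it is [+oo],
    whose inverse is 0, which is the value of the maximum there. *)
Lemma fine_inv_geometric_sqr a :
  fine (\sum_(0 <= l <oo) (a ^+ (2 * l))%:E)^-1%E = Num.max 0 (1 - a ^+ 2).
Proof.
have [a1|a1] := ltP (a ^+ 2) 1.
  have q0 : 0 < 1 - a ^+ 2 by rewrite subr_gt0.
  have -> : (\sum_(0 <= l <oo) (a ^+ (2 * l))%:E)%E = ((1 - a ^+ 2)^-1)%:E.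
    apply/cvg_lim => //.
    have -> : (fun n => \sum_(0 <= l < n) (a ^+ (2 * l))%:E)%E =
        EFin \o series (geometric 1 (a ^+ 2)).
      apply/funext => n /=; rewrite sumEFin; congr (_%:E).
      by apply: eq_bigr => l _; rewrite /= mul1r exprM.
    apply: cvg_EFin; first exact: nearW.
    rewrite -[X in _ --> X]mul1r; apply: cvg_geometric_series.
    by rewrite ger0_norm ?sqr_ge0.
  by rewrite inver gt_eqF ?invr_gt0 //= invrK max_r // ltW.
have -> : (\sum_(0 <= l <oo) (a ^+ (2 * l))%:E)%E = +oo%E.
  (* All terms are at least 1, so the first [n] of them already sum to at least [n], which exceeds
     [b]. *)
  apply/eqyP => b b0; pose n := (Num.truncn b).+1.
  have u0 l : (0 <= (a ^+ (2 * l))%:E)%E.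
    by rewrite lee_fin exprM exprn_ge0 // sqr_ge0.
  apply: (le_trans _ (@nneseries_lim_ge R _ xpredT 0%N n (fun l _ _ => u0 l))).
  rewrite sumEFin lee_fin (le_trans (ltW (truncnS_gt _))) // -/n.
  have -> : n%:R = \sum_(0 <= l < n) 1 :> R.
    by rewrite big_mkord sumr_const card_ord.
  by apply: ler_sum => l _; rewrite exprM exprn_ege1.
by rewrite invey /= max_l // subr_le0.
Qed.

End GeometricSeries.

(** * Real roots of the limit function *)

Section LimitFunction.
Context {R : realType}.
Implicit Types (phi psi phit psit p d c t x y : R).

(** The reciprocal of the series in the limit function, by [fine_inv_geometric_sqr], with [p] for
    [phit] and [d] for [phi - phit]. *)
Definition geometric_residue p d x : R := Num.max 0 (1 - (p + d / x) ^+ 2).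

Lemma geometric_residueN p d x :
  geometric_residue p (- d) (- x) = geometric_residue p d x.
Proof. by rewrite /geometric_residue invrN mulrNN. Qed.

Lemma geometric_residue_ge0 p d x : 0 <= geometric_residue p d x.
Proof. by rewrite le_max lexx. Qed.

Lemma geometric_residue_le1 p d x : geometric_residue p d x <= 1.
Proof. by rewrite ge_max ler01 gerBl sqr_ge0. Qed.

Lemma continuous_geometric_residue p d x : x != 0 ->
  {for x, continuous (geometric_residue p d)}.
Proof.
move=> x0; apply: (@continuous_max R R^o (cst 0)); first exact: cvg_cst.
apply: cvgB; first exact: cvg_cst.
apply: (@cvg_comp _ _ _ (fun y => p + d / y) (fun u => u ^+ 2)); last first.
  exact: exprn_continuous.
by apply: cvgD; [exact: cvg_cst|apply: cvgM; [exact: cvg_cst|exact: cvgV]].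
Qed.

(** Intermediate values on the interval from [x] to [t / c]: since the residue is nonnegative, the
    left-hand side of the equation is at least [t] at the right end. *)
Lemma exists_residue_eq_ge p d c t x : 0 < c -> 0 < x ->
  x * (c + geometric_residue p d x) <= t ->
  exists2 y, x <= y & y * (c + geometric_residue p d y) = t.
Proof.
move=> c0 x0 hx; set f := fun y => y * (c + geometric_residue p d y).
have xt : x <= t / c.
  rewrite ler_pdivlMr //; apply: le_trans hx.
  by rewrite ler_pM2l // lerDl geometric_residue_ge0.
have ft : t <= f (t / c).
  rewrite /f mulrDr divfK ?gt_eqF // lerDl.
  by rewrite mulr_ge0 ?geometric_residue_ge0 // (le_trans _ xt) // ltW.
have [||y] := @IVT R f x (t / c) t xt.
- apply: continuous_in_subspaceT => y /set_mem /=; rewrite in_itv /= => /andP[xy _].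
  have y0 : y != 0 by rewrite gt_eqF // (lt_le_trans x0).
  apply: cvgM; first exact: cvg_id.
  by apply: cvgD; [exact: cvg_cst|exact: continuous_geometric_residue].
- by rewrite ge_min le_max hx ft orbT.
- by rewrite in_itv /= => /andP[xy _] fy; exists y.
Qed.

Lemma f_inftyE phi psi phit psit x : x != 0 ->
  f_infty phi psi phit psit x =
  (psit - psi) / (psit + geometric_residue phit (phi - phit) x) - x.
Proof.
by move=> /negPf x0; rewrite /f_infty x0 /f_infty_expr fine_inv_geometric_sqr.
Qed.

Lemma f_infty_eq0 phi psi phit psit x : 0 < psit -> x != 0 ->
  f_infty phi psi phit psit x = 0 <->
  x * (psit + geometric_residue phit (phi - phit) x) = psit - psi.
Proof.
move=> c0 x0; rewrite f_inftyE //.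
have h : 0 < psit + geometric_residue phit (phi - phit) x.
  by rewrite ltr_wpDr // geometric_residue_ge0.
split; first by move=> /eqP; rewrite subr_eq0 => /eqP e; rewrite -{1}e divfK ?gt_eqF.
by move=> <-; rewrite mulfK ?gt_eqF // subrr.
Qed.

(** For [psit = psi] the fraction vanishes identically, so the expression is [- y] and its limit at
    0 is 0. This supplies a root in the degenerate case. *)
Lemma f_infty_psi0 phi psi phit : f_infty phi psi phit psi 0 = 0.
Proof.
rewrite /f_infty eqxx; apply: cvg_lim => //.
rewrite (_ : f_infty_expr _ _ _ _ = -%R); last first.
  by apply/funext => y; rewrite /f_infty_expr subrr mul0r sub0r.
rewrite -[X in _ --> X]oppr0; apply: cvgN; exact: cvg_within.
Qed.

(** The sign condition makes [x] and [psit - psi] agree in sign. The negative case reduces to the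
    positive one by negating [x], [phi - phit] and [psit - psi] together. *)
Lemma exists_f_infty_root_ge phi psi phit psit x : 0 < psit ->
  0 < x * (psit - psi) ->
  `|x| * (psit + geometric_residue phit (phi - phit) x) <= `|psit - psi| ->
  exists2 y, f_infty phi psi phit psit y = 0 & `|x| <= `|y|.
Proof.
move=> c0; set d := phi - phit; set t := psit - psi.
have [x0 xt|x0|->] := ltrgt0P x; last by rewrite mul0r ltxx.
  have t0 : 0 < t by rewrite -(pmulr_rgt0 _ x0).
  rewrite gtr0_norm // => /(exists_residue_eq_ge _ _ _ _ _ c0 x0)[y xy hy].
  have y0 : 0 < y by exact: lt_le_trans xy.
  exists y; last by rewrite gtr0_norm.
  by apply/f_infty_eq0; rewrite ?gt_eqF.
rewrite nmulr_rgt0 // => t0; rewrite ltr0_norm //.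
rewrite -geometric_residueN -oppr_gt0 in x0 *.
move=> /(exists_residue_eq_ge _ _ _ _ _ c0 x0)[y xy hy].
have y0 : 0 < y by exact: lt_le_trans xy.
exists (- y); last by rewrite normrN gtr0_norm.
apply/f_infty_eq0; rewrite ?oppr_eq0 ?gt_eqF //.
by rewrite -geometric_residueN opprK mulNr hy opprK.
Qed.

(** Induction on the list of candidates: either the head is already maximal, or the induction
    hypothesis is applied to the solutions of strictly larger norm, which excludes the head. *)
Lemma exists_max_norm (P : R -> Prop) (s : seq R) :
  (forall x, P x -> x \in s) -> (exists x, P x) ->
  exists2 x, P x & forall y, P y -> `|y| <= `|x|.
Proof.
elim: s P => [|a s IH] P sP [x Px]; first by have := sP x Px.
have [Pa|nPa] := pselect (P a); last first.
  apply: IH; last by exists x.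
  move=> y Py; have := sP y Py; rewrite inE => /predU1P[ya|//].
  by rewrite ya in Py.
have [[z [Pz za]]|no] := pselect (exists z, P z /\ `|a| < `|z|); last first.
  exists a => // y Py; rewrite leNgt; apply/negP => ay.
  by apply: no; exists y.
have [||m [Pm am] mmax] := IH (fun z => P z /\ `|a| < `|z|).
- move=> y [/sP]; rewrite inE => /predU1P[->|//]; by rewrite ltxx.
- by exists z.
exists m => // y Py; have [ya|ay] := leP `|y| `|a|; last by apply: mmax.
exact: le_trans ya (ltW am).
Qed.

(* Where [|phit + (phi - phit) / x| < 1] the equation [f_infty x = 0] is
   quadratic in [x]; elsewhere it reads [x = (psit - psi) / psit]. *)
Lemma f_infty_root_mem phi psi phit psit x : 0 < psit -> 0 < phit < 1 ->
  let A := psit + 1 - phit ^+ 2 in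
  let B := psit - psi + 2 * phit * (phi - phit) in
  let D := Num.sqrt (B ^+ 2 + 4 * A * (phi - phit) ^+ 2) in
  f_infty phi psi phit psit x = 0 ->
  x \in [:: 0; (psit - psi) / psit; (B + D) / (2 * A); (B - D) / (2 * A)].
Proof.
move=> c0 /andP[p0 p1] A B D; rewrite !inE.
have [//|x0 /f_infty_eq0-/(_ c0 x0)] := eqVneq x 0.
have A0 : 0 < A by rewrite /A; nra.
rewrite /geometric_residue; case: leP => _ h; last first.
  have -> : (psit - psi) / psit = x by rewrite -h addr0 mulfK ?gt_eqF.
  by rewrite eqxx orbT.
(* The quadratic is [A * x ^+ 2 - B * x - (phi - phit) ^+ 2 = 0]; multiplying it by [4 * A]
   completes the square. *)
have hq : (2 * A * x - B) ^+ 2 = D ^+ 2.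
  rewrite sqr_sqrtr; last first.
    by rewrite addr_ge0 ?sqr_ge0 // mulr_ge0 ?sqr_ge0 // mulr_ge0 // ltW.
  have : A * x ^+ 2 - B * x - (phi - phit) ^+ 2 = 0.
    by rewrite /A /B -h; field.
  by move=> q; apply/eqP; rewrite -subr_eq0 -(mulr0 (4 * A)) -q; apply/eqP; ring.
have A2 : 2 * A != 0 by rewrite gt_eqF // mulr_gt0.
move/eqP: hq; rewrite eqf_sqr => /orP[] /eqP hq; apply/orP; right; apply/orP; right.
  by apply/orP; left; rewrite -hq subrKC [_ * x]mulrC mulfK.
by apply/orP; right; rewrite -hq subrKC [_ * x]mulrC mulfK.
Qed.

Lemma exists_largest_root phi psi phit psit : 0 < psit -> 0 < phit < 1 ->
  exists x, largest_root (f_infty phi psi phit psit) x.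
Proof.
move=> c0 p01.
have [|x fx xmax] := exists_max_norm (fun x => f_infty phi psi phit psit x = 0)
    _ (fun x => f_infty_root_mem _ _ _ _ _ c0 p01); last by exists x.
have [<-|t0] := eqVneq psi psit; first by exists 0; exact: f_infty_psi0.
have t1 : psit - psi != 0 by rewrite subr_eq0 eq_sym.
have c1 : 0 < psit + 1 by rewrite addr_gt0.
(* The residue is at most 1, so the point [(psit - psi) / (psit + 1)] satisfies the required
   inequality. *)
have [||y fy _] := exists_f_infty_root_ge phi psi phit psit
    ((psit - psi) / (psit + 1)) c0; last by exists y.
- by rewrite mulrAC -expr2 divr_gt0 // exprn_even_gt0.
- rewrite normrM normfV (gtr0_norm c1) -mulrA ler_piMr //.
  by rewrite ler_pdivrMl // mulr1 lerD2l geometric_residue_le1.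
Qed.

End LimitFunction.

(** * Invertibility of the optimality system by diagonalization *)

Section ParaOptMatrix.
Context {F : fieldType}.

(** Rows are time sub-intervals and columns are state components, so a Kronecker product acts by
    multiplication on both sides, as [mxreshape_tens] states. *)
Definition mxreshape (L M : nat) (v : 'cV[F]_(L * M)) : 'M[F]_(L, M) :=
  \matrix_(j, k) v (mxtens_index (j, k)) 0.

Arguments mxreshape {L M} v.

Lemma mxreshape_eq0 L M (v : 'cV[F]_(L * M)) : mxreshape v = 0 -> v = 0.
Proof.
move=> /matrixP h; apply/colP => k; rewrite -(mxtens_unindexK k).
by case: (mxtens_unindex k) => i j; have := h i j; rewrite !mxE.
Qed.

Lemma mxreshapeD L M (v w : 'cV[F]_(L * M)) :
  mxreshape (v + w) = mxreshape v + mxreshape w.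
Proof. by apply/matrixP => i j; rewrite !mxE. Qed.

Lemma mxreshapeN L M (v : 'cV[F]_(L * M)) : mxreshape (- v) = - mxreshape v.
Proof. by apply/matrixP => i j; rewrite !mxE. Qed.

Lemma mxreshape0 L M : mxreshape (0 : 'cV[F]_(L * M)) = 0.
Proof. by apply/matrixP => i j; rewrite !mxE. Qed.

Lemma mxreshape_tens L M (A : 'M[F]_L) (B : 'M[F]_M) (v : 'cV[F]_(L * M)) :
  mxreshape (tensmx A B *m v) = A *m mxreshape v *m B^T.
Proof.
apply/matrixP => i j; rewrite !mxE.
rewrite (reindex (@mxtens_index L M)) /=; last first.
  by exists (@mxtens_unindex L M) => k _; rewrite ?mxtens_indexK ?mxtens_unindexK.
rewrite (eq_bigr
  (fun k => (A i k.1 * B j k.2) * v (mxtens_index k) 0)); last first.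
  by case=> k l _; rewrite tensmxE.
rewrite (eq_bigr
  (fun k => A i k.1 * B j k.2 * v (mxtens_index (k.1, k.2)) 0)); last by case.
rewrite -(pair_bigA _ (fun k l => A i k * B j l * v (mxtens_index (k, l)) 0)) /=.
rewrite exchange_big /=; apply: eq_bigr => l _; rewrite !mxE mulr_suml.
by apply: eq_bigr => k _; rewrite !mxE; ring.
Qed.

(* The blocks of [paraopt_mx] over an arbitrary field: the eigenvalue problem
   lives over [R[i]]. *)
Definition shift_mx L : 'M[F]_L := \matrix_(i, j) (i == j.+1 :> nat)%:R.

Definition last_mx L : 'M[F]_L :=
  \matrix_(i, j) ((i.+1 == L) && (j.+1 == L))%:R.

Definition optimality_mx L M (Phi Psi : 'M[F]_M) : 'M[F]_(L * M + L * M) :=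
  block_mx (tensmx 1%:M 1%:M - tensmx (shift_mx L) Phi) (tensmx 1%:M Psi)
           (- tensmx (last_mx L) 1%:M)
           (tensmx 1%:M 1%:M - tensmx (shift_mx L)^T Phi).

Lemma sum_nat_eq n (f : 'I_n.+1 -> F) (P : 'I_n.+1 -> bool) (k : nat) :
  (k <= n)%N -> (forall i, P i = (i == k :> nat)) ->
  \sum_i (P i)%:R * f i = f (inord k).
Proof.
move=> kn hP; rewrite (bigD1 (inord k)) //= hP inordK // eqxx mul1r.
rewrite big1 ?addr0 // => i ik; rewrite hP; case: eqP => [e|]; last by rewrite mul0r.
by move: ik; rewrite -e inord_val eqxx.
Qed.

Lemma shift_mx_mul0 n (y : 'cV[F]_n.+1) : (shift_mx n.+1 *m y) (inord 0) 0 = 0.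
Proof. by rewrite !mxE big1 // => i _; rewrite mxE inordK // mul0r. Qed.

Lemma shift_mx_mulS n (y : 'cV[F]_n.+1) j : (j < n)%N ->
  (shift_mx n.+1 *m y) (inord j.+1) 0 = y (inord j) 0.
Proof.
move=> jn; rewrite !mxE; under eq_bigr do rewrite mxE.
apply: sum_nat_eq => [|i]; first exact: ltnW.
by rewrite inordK // eqSS eq_sym.
Qed.

Lemma tr_shift_mx_mul n (y : 'cV[F]_n.+1) j : (j < n)%N ->
  ((shift_mx n.+1)^T *m y) (inord j) 0 = y (inord j.+1) 0.
Proof.
move=> jn; rewrite !mxE; under eq_bigr do rewrite !mxE.
by apply: sum_nat_eq => [|i]; rewrite ?inordK // ltnW.
Qed.

Lemma tr_shift_mx_mul_last n (y : 'cV[F]_n.+1) :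
  ((shift_mx n.+1)^T *m y) (inord n) 0 = 0.
Proof.
rewrite !mxE big1 // => i _; rewrite !mxE inordK // ltn_eqF ?mul0r //.
Qed.

Lemma last_mx_mul n (y : 'cV[F]_n.+1) j : (j <= n)%N ->
  (last_mx n.+1 *m y) (inord j) 0 = (j == n)%:R * y (inord n) 0.
Proof.
move=> jn; rewrite !mxE; under eq_bigr do rewrite mxE.
rewrite inordK // eqSS; case: eqP => _ /=; last first.
  by rewrite mul0r big1 // => i _; rewrite mul0r.
by rewrite mul1r; apply: sum_nat_eq.
Qed.

(* Backward substitution gives [l_j = a^(n-j) y_n]; forward substitution then
   gives [y_n = - c (\sum_i a^(2i)) y_n]. *)
Lemma scalar_optimality_system n (a c : F) (y l : 'cV[F]_n.+1) :
  1 + c * (\sum_(i < n.+1) a ^+ (2 * i)) != 0 ->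
  y - a *: (shift_mx n.+1 *m y) + c *: l = 0 ->
  - (last_mx n.+1 *m y) + (l - a *: ((shift_mx n.+1)^T *m l)) = 0 ->
  y = 0 /\ l = 0.
Proof.
move=> hne /colP e1 /colP e2.
have {}e1 j : y (inord j) 0 - a * (shift_mx n.+1 *m y) (inord j) 0
    + c * l (inord j) 0 = 0.
  by have := e1 (inord j); rewrite !mxE.
have {}e2 j : - (last_mx n.+1 *m y) (inord j) 0
    + (l (inord j) 0 - a * ((shift_mx n.+1)^T *m l) (inord j) 0) = 0.
  by have := e2 (inord j); rewrite !mxE.
have hl k : (k <= n)%N -> l (inord (n - k)) 0 = a ^+ k * y (inord n) 0.
  elim: k => [_|k IH kn].
    have := e2 n; rewrite subn0 last_mx_mul // eqxx tr_shift_mx_mul_last.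
    by rewrite !mul1r mulr0 subr0 addrC => /eqP; rewrite subr_eq0 => /eqP.
  have nk : (n - k.+1 < n)%N by rewrite ltn_subrL (leq_trans _ kn).
  have := e2 (n - k.+1)%N; rewrite last_mx_mul 1?ltnW // ltn_eqF //.
  rewrite tr_shift_mx_mul // -subSn // subSS mul0r oppr0 add0r.
  rewrite (IH (ltnW kn)) mulrA -exprS => /eqP.
  by rewrite subr_eq0 => /eqP.
have hy j : (j <= n)%N ->
    y (inord j) 0 = - c * \sum_(i < j.+1) a ^+ (j - i) * l (inord i) 0.
  elim: j => [_|j IH jn].
    have := e1 0%N; rewrite shift_mx_mul0 mulr0 subr0 big_ord1 mul1r.
    by move/eqP; rewrite addr_eq0 mulNr => /eqP.
  have := e1 j.+1; rewrite shift_mx_mulS // (IH (ltnW jn)) => e.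
  rewrite big_ord_recr /= subnn expr0 mul1r.
  have -> : \sum_(i < j.+1) a ^+ (j.+1 - i) * l (inord i) 0 =
      a * \sum_(i < j.+1) a ^+ (j - i) * l (inord i) 0.
    rewrite mulr_sumr; apply: eq_bigr => i _.
    by rewrite subSn -1?ltnS // exprS mulrA.
  by apply/eqP; rewrite -subr_eq0; apply/eqP; rewrite -[RHS]e; ring.
have yn0 : y (inord n) 0 = 0.
  have := hy n (leqnn n).
  rewrite (eq_bigr
    (fun i : 'I_n.+1 => a ^+ (2 * (n - i)) * y (inord n) 0)); last first.
    move=> i _; rewrite -[X in l (inord X)](subKn (leq_ord i)) hl ?leq_subr //.
    by rewrite mulrA -exprD addnn mul2n.
  rewrite -mulr_suml (reindex_inj rev_ord_inj) /=.
  rewrite (eq_bigr (fun i : 'I_n.+1 => a ^+ (2 * i))); last first.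
    by move=> i _; rewrite subSS subKn // leq_ord.
  move: hne; set S := \sum_i _ => hne e; apply/eqP; rewrite -/S in e.
  have /eqP : (1 + c * S) * y (inord n) 0 = 0.
    by rewrite mulrDl mul1r {1}e; ring.
  by rewrite mulf_eq0 (negPf hne).
have l0 i : (i <= n)%N -> l (inord i) 0 = 0.
  by move=> i_n; rewrite -(subKn i_n) hl ?leq_subr // yn0 mulr0.
split; apply/colP => j; rewrite mxE -(inord_val j) ?l0 ?leq_ord //.
rewrite hy ?leq_ord // big1 ?mulr0 // => i _.
by rewrite l0 ?mulr0 // -ltnS (leq_trans (ltn_ord i)).
Qed.

(** A kernel vector is reshaped and multiplied on the right by the transposed inverse of [V]. This
    diagonalizes the transposes of [Phi] and [Psi], so each column solves a scalar system with only
    the zero solution. *)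
Lemma optimality_mx_unit n M (Phi Psi V : 'M[F]_M) (a c : 'I_M -> F) :
  V \in unitmx -> Phi *m V = V *m diag_mx (\row_i a i) ->
  Psi *m V = V *m diag_mx (\row_i c i) ->
  (forall i, 1 + c i * (\sum_(l < n.+1) a i ^+ (2 * l)) != 0) ->
  optimality_mx n.+1 M Phi Psi \in unitmx.
Proof.
move=> Vu PhiV PsiV hne.
(* [det0P] yields a row vector, so the matrix is transposed first in order to obtain a column vector
   in its kernel. *)
rewrite -unitmx_tr unitmxE unitfE; apply/det0P => -[v v0 hv].
have {}hv : optimality_mx n.+1 M Phi Psi *m v^T = 0.
  by apply: trmx_inj; rewrite trmx_mul trmxK hv trmx0.
have WE (X : 'M[F]_M) (d : 'I_M -> F) : X *m V = V *m diag_mx (\row_i d i) ->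
    X^T *m (invmx V)^T = (invmx V)^T *m diag_mx (\row_i d i).
  move=> XV; rewrite -[diag_mx _]tr_diag_mx -!trmx_mul; congr (_^T).
  by rewrite -[LHS]mulmx1 -(mulmxV Vu) mulmxA -(mulmxA _ X) XV mulmxA mulVmx ?mul1mx.
set W := (invmx V)^T in WE.
have Wu : W \in unitmx by rewrite unitmx_tr unitmx_inv.
pose y := mxreshape (usubmx v^T); pose l := mxreshape (dsubmx v^T).
suff [y0 l0] : y = 0 /\ l = 0.
  case/negP: v0; rewrite -[v]trmxK -[v^T]vsubmxK.
  by rewrite (mxreshape_eq0 _ _ _ y0) (mxreshape_eq0 _ _ _ l0) col_mx0 trmx0.
move: hv; rewrite -[v^T]vsubmxK mul_block_col -col_mx0 => /eq_col_mx[].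
rewrite !mulmxBl mulNmx => /(congr1 (fun u => mxreshape u *m W)) h1.
move=> /(congr1 (fun u => mxreshape u *m W)) h2.
move: h1 h2; rewrite !(mxreshapeD, mxreshapeN) !mxreshape0 !mul0mx.
rewrite !mxreshape_tens !trmx1 !mulmx1 !mul1mx -/y -/l.
rewrite !(mulmxDl, mulNmx) -!mulmxA (WE _ _ PhiV) (WE _ _ PsiV).
rewrite !mulmxA => h1 h2.
suff [y0 l0] : y *m W = 0 /\ l *m W = 0.
  by rewrite -[y](mulmxK Wu) -[l](mulmxK Wu) y0 l0 !mul0mx.
have colD (X : 'M[F]_(n.+1, M)) (d : 'I_M -> F) i :
    X *m diag_mx (\row_j d j) *m delta_mx i 0 =
    d i *: (X *m delta_mx i 0) :> 'cV_ _.
  by rewrite -!colE; apply/colP => j; rewrite mul_mx_diag !mxE mulrC.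
have hi i : col i (y *m W) = 0 /\ col i (l *m W) = 0.
  rewrite !colE; apply: (scalar_optimality_system _ _ _ _ _ (hne i)).
    have := congr1 (mulmx^~ (delta_mx i 0 : 'cV_M)) h1.
    by rewrite /= !mulmxDl !mulNmx mul0mx !colD -!mulmxA.
  have := congr1 (mulmx^~ (delta_mx i 0 : 'cV_M)) h2.
  by rewrite /= !mulmxDl !mulNmx mul0mx !colD -!mulmxA.
by split; apply/matrixP => j i; have [/colP/(_ j) + /colP/(_ j)] := hi i; rewrite !mxE.
Qed.

End ParaOptMatrix.

Lemma map_optimality_mx (F F' : fieldType) (f : {rmorphism F -> F'}) L M
    (Phi Psi : 'M[F]_M) :
  map_mx f (optimality_mx L M Phi Psi) =
  optimality_mx L M (map_mx f Phi) (map_mx f Psi).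
Proof.
have shiftE : map_mx f (shift_mx L) = shift_mx L.
  by apply/matrixP => i j; rewrite !mxE rmorph_nat.
have lastE : map_mx f (last_mx L) = last_mx L.
  by apply/matrixP => i j; rewrite !mxE rmorph_nat.
rewrite /optimality_mx map_block_mx map_mxN !map_mxB !map_mxT !map_mx1 /=.
by rewrite -map_trmx shiftE lastE.
Qed.

(** The matrix is affine in [Phi] and [Psi], and its constant part gets the coefficient
    [1 - (1 - z) = z]. *)
Lemma optimality_mx_pencil (F : fieldType) L M (Phi Psi Phit Psit : 'M[F]_M)
    (z : F) : z != 0 ->
  z *: optimality_mx L M (Phit + z^-1 *: (Phi - Phit))
                         (Psit + z^-1 *: (Psi - Psit)) =
  optimality_mx L M Phi Psi - (1 - z) *: optimality_mx L M Phit Psit.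
Proof.
move=> z0; rewrite /optimality_mx !scale_block_mx opp_block_mx add_block_mx.
by congr block_mx; apply/matrixP => i j; rewrite !mxE; field.
Qed.

Lemma diagonalized_by_diag_mx (R : realType) M (V X : 'M[R]_M) (d : 'I_M -> R) :
  diagonalized_by V X d -> X *m V = V *m diag_mx (\row_i d i).
Proof.
move=> h; apply/matrixP => j i; have /colP/(_ j) := h i.
by rewrite mul_mx_diag colE mulmxA -colE -colE !mxE [RHS]mulrC.
Qed.

(** * Nonzero eigenvalues of the iteration matrix *)

Section Spectrum.
Context {R : realType}.
Local Notation normc := (@Normc.normc R).
Local Notation Re := (@complex.Re R).
Local Notation Im := (@complex.Im R).
Local Open Scope complex_scope.

Lemma paraopt_eigenvalue M n (Phi Psi Phit Psit V : 'M[R]_M)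
    (phi psi phit psit : 'I_M -> R) (z : R[i]) :
  V \in unitmx ->
  diagonalized_by V Phi phi -> diagonalized_by V Psi psi ->
  diagonalized_by V Phit phit -> diagonalized_by V Psit psit ->
  (forall i, 0 < psit i) ->
  eigenvalue (map_mx (real_complex R) (paraopt_iter_mx n.+1 Phi Psi Phit Psit)) z ->
  z != 0 ->
  exists i, 1 + ((psit i)%:C + z^-1 * ((psi i)%:C - (psit i)%:C)) *
    (\sum_(l < n.+1) ((phit i)%:C + z^-1 * ((phi i)%:C - (phit i)%:C)) ^+ (2 * l)) = 0.
Proof.
move=> Vu /diagonalized_by_diag_mx dP /diagonalized_by_diag_mx dS.
move=> /diagonalized_by_diag_mx dPt /diagonalized_by_diag_mx dSt psit0.
move=> /eigenvalueP[v hv v0] z0; apply: contrapT => hne.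
set f := real_complex R in hv.
have mapD (X : 'M[R]_M) (d : 'I_M -> R) : X *m V = V *m diag_mx (\row_i d i) ->
    map_mx f X *m map_mx f V = map_mx f V *m diag_mx (\row_i (d i)%:C).
  move=> h; rewrite -map_mxM h map_mxM map_diag_mx; congr (_ *m diag_mx _).
  by apply/rowP => i; rewrite !mxE.
have pencilD (X Y : 'M[R]_M) (d e : 'I_M -> R) :
    X *m V = V *m diag_mx (\row_i d i) -> Y *m V = V *m diag_mx (\row_i e i) ->
    (map_mx f Y + z^-1 *: (map_mx f X - map_mx f Y)) *m map_mx f V =
    map_mx f V *m diag_mx (\row_i ((e i)%:C + z^-1 * ((d i)%:C - (e i)%:C))).
  move=> /mapD hX /mapD hY; rewrite mulmxDl -scalemxAl mulmxBl hX hY.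
  rewrite !mul_mx_diag; apply/matrixP => i j; rewrite !mxE; ring.
pose At := optimality_mx n.+1 M Phit Psit.
have Atu : At \in unitmx.
  apply: (optimality_mx_unit _ _ _ _ _ _ _ Vu dPt dSt) => i.
  rewrite gt_eqF // ltr_pwDl ?ltr01 // (mulr_ge0 (ltW (psit0 i))) // sumr_ge0 // => l _.
  by rewrite exprM exprn_ge0 // sqr_ge0.
have := optimality_mx_unit n M _ _ _ _ _ _ (pencilD _ _ _ _ dP dPt)
   (pencilD _ _ _ _ dS dSt).
rewrite map_unitmx => /(_ Vu)-Ou.
have {}Ou : optimality_mx n.+1 M
    (map_mx f Phit + z^-1 *: (map_mx f Phi - map_mx f Phit))
    (map_mx f Psit + z^-1 *: (map_mx f Psi - map_mx f Psit)) \in unitmx.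
  by apply: Ou => i; apply/eqP => h; apply: hne; exists i.
have Atu' : map_mx f At \in unitmx by rewrite map_unitmx.
(* For a left eigenvector [v], the vector [w] lies in the left kernel of the pencil; if no scalar
   equation held, the pencil would be invertible and [v] would vanish. *)
pose w := v *m invmx (map_mx f At).
have vE : v = w *m map_mx f At by rewrite /w mulmxKV.
have hw : w *m map_mx f (optimality_mx n.+1 M Phi Psi) = (1 - z) *: v.
  rewrite scalerBl scale1r -hv /paraopt_iter_mx map_mxB map_mx1 mulmxBr mulmx1.
  by rewrite map_mxM map_invmx mulmxA subKr.
have : w *m (z *: optimality_mx n.+1 M
    (map_mx f Phit + z^-1 *: (map_mx f Phi - map_mx f Phit))
    (map_mx f Psit + z^-1 *: (map_mx f Psi - map_mx f Psit))) = 0.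
  rewrite optimality_mx_pencil // -!map_optimality_mx mulmxBr hw -scalemxAr.
  by rewrite -vE subrr.
rewrite -scalemxAr => /eqP; rewrite scaler_eq0 (negPf z0) /= => /eqP hw0.
case/negP: v0; rewrite vE -[w](mulmxK Ou) hw0 mul0mx mul0mx; exact: eqxx.
Qed.

(* The eigenvalue equation, multiplied by [conj s], gives
   [Im (z * conj s) + c |s|^2 Im z = 0], and the two terms have the sign of
   [Im z]. *)
Lemma eigenvalue_real p d c t (z : R[i]) n : 0 <= p -> 0 < c -> z != 0 ->
  let a := p%:C + d%:C / z in
  let s := \sum_(l < n.+1) a ^+ (2 * l) in
  z + (c%:C * z - t%:C) * s = 0 -> `|d| <= (1 - p) * normc z -> Im z = 0.
Proof.
move=> p0 c0 z0 a s hs hd.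
have nz : 0 < normc z.
  rewrite lt_def normc_ge0 andbT; apply: contra z0 => /eqP /Normc.eq0_normc ->.
  exact: eqxx.
have zaE : z * (a - p%:C) = d%:C by rewrite /a addrC addKr mulrC divfK.
have zs0 : 0 <= Im z * Im (z * s^*).
  (* If [d = 0] then [s] is real and nonnegative. Otherwise the sign comes from [Im_geometric_sum]
     after scaling by the fourth power of [normc z], which leaves the positive factor [d ^+ 2]. *)
  have [d0|d0] := eqVneq d 0.
    have -> : s = (\sum_(l < n.+1) p ^+ (2 * l))%:C.
      rewrite rmorph_sum; apply: eq_bigr => l _.
      by rewrite /a d0 rmorphXn rmorph0 mul0r addr0.
    set u := \sum_i _; have u0 : 0 <= u by apply: sumr_ge0 => l _; exact: exprn_ge0.
    have -> : Im z * Im (z * u%:C^*) = Im z ^+ 2 * u by case: (z) => x y /=; ring.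
    by rewrite mulr_ge0 ?sqr_ge0.
  have ha : normc (a - p%:C) <= 1 - p.
    by rewrite -(ler_pM2l nz) -Normc.normcM zaE normc_real mulrC.
  have := Im_geometric_sum a p n p0 ha; rewrite -/s.
  rewrite -(pmulr_rge0 _ (exprn_gt0 4 nz)).
  have -> : normc z ^+ 4 * (Im a * Im ((a - p%:C) * s)) =
      (normc z ^+ 2 * Im (a - p%:C)) * (normc z ^+ 2 * Im ((a - p%:C) * s)).
    have -> : Im (a - p%:C) = Im a by case: (a) => x y /=; ring.
    ring.
  rewrite !sqr_normcM_Im [z * (_ * s)]mulrA !zaE.
  have -> : Im (z^* * d%:C) * Im (z^* * (d%:C * s)) = d ^+ 2 * (Im z * Im (z * s^*)).
    by case: (z) => x y; case: (s) => u v /=; ring.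
  by rewrite pmulr_rge0 // exprn_even_gt0.
have key : Im z * Im (z * s^*) + c * (normc s * Im z) ^+ 2 = 0.
  rewrite exprMn normc_sqrE; move: hs => /eqP; rewrite eq_complex => /andP[/eqP h1 /eqP h2].
  have -> : Im z * Im (z * s^*) + c * ((Re s ^+ 2 + Im s ^+ 2) * Im z ^+ 2) =
     Im z * (Re s * Im (z + (c%:C * z - t%:C) * s)
             - Im s * Re (z + (c%:C * z - t%:C) * s)).
    by case: (z) => x y; case: (s) => u v /=; ring.
  by rewrite h1 h2 /= !mulr0 subrr mulr0.
have : c * (normc s * Im z) ^+ 2 <= 0 by rewrite -key lerDr.
rewrite pmulr_rle0 // => h.
have /eqP : (normc s * Im z) ^+ 2 == 0 by rewrite eq_le h sqr_ge0.
(* Either [Im z = 0] or [s = 0], and the latter would force [z = 0] by [hs]. *)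
move/eqP; rewrite sqrf_eq0 mulf_eq0 => /orP[/eqP/Normc.eq0_normc s0|/eqP//].
by move/eqP: hs; rewrite s0 mulr0 addr0 (negPf z0).
Qed.

(** The equation reads [t * s = x * (1 + c * s)] with [s] positive, which gives the sign. The bound
    follows because the residue times the truncated sum [s] is at most 1. *)
Lemma real_eigenvalue_bound p d c t (x : R) n : 0 < c -> x != 0 ->
  let s := \sum_(l < n.+1) (p + d / x) ^+ (2 * l) in
  x + (c * x - t) * s = 0 ->
  0 < x * t /\ `|x| * (c + geometric_residue p d x) <= `|t|.
Proof.
move=> c0 x0 s hs; have s0 : 0 < s.
  rewrite /s big_ord_recl muln0 expr0 ltr_pwDl ?ltr01 // sumr_ge0 // => l _.
  by rewrite exprM exprn_ge0 // sqr_ge0.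
have ts : t * s = x * (1 + c * s).
  by apply/eqP; rewrite eq_sym -subr_eq0; apply/eqP; rewrite -[RHS]hs; ring.
have cs : 0 < 1 + c * s by rewrite addr_gt0 ?mulr_gt0.
split.
  by rewrite -(pmulr_lgt0 _ s0) -mulrA ts mulrA -expr2 mulr_gt0 // exprn_even_gt0.
rewrite -(ler_pM2r s0) -[X in _ <= _ * X]gtr0_norm // -normrM ts normrM (gtr0_norm cs).
rewrite -mulrA ler_wpM2l // mulrDl addrC lerD2r /geometric_residue.
have [_|_] := leP 0 (1 - (p + d / x) ^+ 2); last by rewrite mul0r ler01.
by rewrite geometric_sqrE gerBl exprM exprn_ge0 // sqr_ge0.
Qed.

End Spectrum.

Theorem theorem3p12 (R : realType) (M L : nat) (M_gt0 : (0 < M)%N)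
  (L_gt0 : (0 < L)%N)
  (K Phi Psi Phit Psit : 'M[R]_M)
  (P Q Pt Qt : 'I_L -> 'cV[R]_M -> 'cV[R]_M -> 'cV[R]_M)
  (fine_affine : affine_propagators Phi Psi 0 Phi P Q)
  (coarse_affine : affine_propagators Phit Psit 0 Phit Pt Qt)
  (K_sym : K^T = K)
  (K_pos : forall s : R, eigenvalue K s -> 0 < s)
  (V : 'M[R]_M) (sigma phi psi phit psit : 'I_M -> R)
  (V_unit : V \in unitmx)
  (K_diag : diagonalized_by V K sigma)
  (Phi_diag : diagonalized_by V Phi phi)
  (Psi_diag : diagonalized_by V Psi psi)
  (Phit_diag : diagonalized_by V Phit phit)
  (Psit_diag : diagonalized_by V Psit psit)
  (phi_bnd : forall i, 0 < phi i < 1)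
  (phit_bnd : forall i, 0 < phit i < 1)
  (psi_gt0 : forall i, 0 < psi i)
  (psit_gt0 : forall i, 0 < psit i) :
  (forall i, exists x : R,
     largest_root (f_infty (phi i) (psi i) (phit i) (psit i)) x) /\
  (forall xs : 'I_M -> R,
     (forall i, largest_root (f_infty (phi i) (psi i) (phit i) (psit i)) (xs i)) ->
     spectral_radius (paraopt_iter_mx L Phi Psi Phit Psit)
       <= rho_star phi phit xs).
Proof.
split=> [i|xs xsP]; first exact: exists_largest_root.
have rho_ge i y : y <= `|phi i - phit i| / (1 - phit i) \/ y <= `|xs i| ->
    y <= rho_star phi phit xs.
  move=> hy; apply: le_trans (le_bigmax _ _ i); rewrite le_max.
  by case: hy => ->; rewrite ?orbT.
have rho0 : 0 <= rho_star phi phit xs.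
  by apply: (rho_ge (Ordinal M_gt0)); right; exact: normr_ge0.
case: L L_gt0 {P Q Pt Qt fine_affine coarse_affine} => [//|n] _.
rewrite /spectral_radius; set S := [set _ | _ in _].
(* The [sup] of the empty set is 0, so nonemptiness of the spectrum need not be established. *)
have [->|/set0P S0] := eqVneq S set0; first by rewrite sup0.
apply: ge_sup => // _ [z /= zeig <-].
have [->|z0] := eqVneq z 0; first by rewrite Normc.normc0.
have [i hi] := paraopt_eigenvalue _ _ _ _ _ _ _ _ _ _ _ _ V_unit
  Phi_diag Psi_diag Phit_diag Psit_diag psit_gt0 zeig z0.
apply: (rho_ge i); have /andP[p0 p1] := phit_bnd i; have c0 := psit_gt0 i.
have q0 : 0 < 1 - phit i by rewrite subr_gt0.
rewrite ler_pdivlMr // mulrC.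
(* A small modulus is bounded by the first term of the maximum. A larger one forces [z] to be real,
   and a root of the limit function then dominates it. *)
have [|/ltW hd] := leP ((1 - phit i) * Normc.normc z) `|phi i - phit i|.
  by left.
right; set d := phi i - phit i in hd; set t := psit i - psi i.
(* This is the eigenvalue equation multiplied by [z]. *)
have hs : z + (real_complex R (psit i) * z - real_complex R t) *
    (\sum_(l < n.+1)
       (real_complex R (phit i) + real_complex R d / z) ^+ (2 * l)) = 0.
  have subC u v : real_complex R (u - v) = real_complex R u - real_complex R v.
    exact: rmorphB.
  move: hi; rewrite -!subC !(mulrC z^-1) -/d.
  set s := \sum_l _ => hi; rewrite -[RHS](mulr0 z) -hi /t !subC.
  by field.
have := eigenvalue_real _ _ _ _ _ _ (ltW p0) c0 z0 hs hd.
move: hs z0 {zeig hi hd}; case: z => x y hs z0 y0.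
have {}y0 : y = 0 := y0; rewrite {}y0 complexr0 in hs z0 *.
have x0 : x != 0 by apply: contra z0 => /eqP ->.
have hr : x + (psit i * x - t) * (\sum_(l < n.+1) (phit i + d / x) ^+ (2 * l)) = 0.
  apply: (@complexI R); rewrite rmorph0 -[RHS]hs rmorphD rmorphM rmorphB rmorphM.
  rewrite rmorph_sum; congr (_ + _ * _); apply: eq_bigr => l _.
  by rewrite rmorphXn rmorphD fmorph_div.
have [xt hx] := real_eigenvalue_bound _ _ _ _ _ _ c0 x0 hr.
have [r fr xr] := exists_f_infty_root_ge _ _ _ _ _ c0 xt hx.
rewrite normc_real; apply: (le_trans xr).
by have [_] := xsP i; apply.
Qed.
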